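(* Let $k$ be a field of characteristic zero and let $\mathfrak{m}_0$ be the Lie algebra over $k$ with basis $e_i$, $i\geq 1$, whose only nonzero brackets (up to skew-symmetry) are $[e_1,e_i]=e_{i+1}$ for $i\geq 2$. Then $$\dim H^1_l(\mathfrak{m}_0,\mathfrak{m}_0)=\begin{cases}1 & \text{for } l\geq 1,\\ 2 & \text{for } l=0,\\ 0 & \text{for } l\leq -1.\end{cases}$$
   Context: For $l\in\mathbb{Z}$, $H^1_l(\mathfrak{m}_0,\mathfrak{m}_0)$ is the weight-$l$ component of the first Chevalley–Eilenberg cohomology with adjoint coefficients: the quotient of the space of derivations $\omega$ of the form $\omega(e_i)=a_ie_{i+l}$ for all $i\ge 1$ (scalars $a_i$, with $e_s:=0$ for $s\leq 0$) by the subspace of those that are inner derivations. *)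

(* Defs.v *)
From HB Require Import structures.
From mathcomp Require Import all_boot all_order all_algebra.
From mathcomp Require Import boolp functions.
From mathcomp Require Import ring.

Set Implicit Arguments.
Unset Strict Implicit.
Unset Printing Implicit Defensive.

Import GRing.Theory.
Local Open Scope ring_scope.
Local Open Scope quotient_scope.

HB.mixin Record Lmodule_isLieAlgebra (k : fieldType) (L : Type)
    of GRing.Lmodule k L := {
  lie : L -> L -> L;
  lie_linearl : forall y : L, linear (fun x => lie x y);
  lie_linearr : forall x : L, linear (lie x);
  liexx : forall x : L, lie x x = 0;
  lie_jacobi : forall x y z : L,
    lie x (lie y z) + lie y (lie z x) + lie z (lie x y) = 0
}.

#[short(type="lieAlgType")]
HB.structure Definition LieAlgebra (k : fieldType) :=
  { L of GRing.Lmodule k L & Lmodule_isLieAlgebra k L }.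

(* [ring_quotient] only equips [{quot B}] with a [zmodType] structure. *)
Section LmodQuotient.
Variables (k : fieldType) (V : lmodType k) (B : submodClosed V).

Fact submod_zmod_closed : zmod_closed B.
Proof.
split=> [|x y Bx By]; first exact: rpred0.
by rewrite -scaleN1r rpredD // rpredZ.
Qed.

Definition submod_pred : {pred V} := fun x => x \in B.
HB.instance Definition _ := GRing.isZmodClosed.Build V submod_pred submod_zmod_closed.

Definition lmod_quot : Type := @Quotient.quot V submod_pred.
HB.instance Definition _ := GRing.Zmodule.on lmod_quot.
HB.instance Definition _ : EqQuotient V (Quotient.equiv submod_pred) lmod_quot :=
  EqQuotient.on lmod_quot.

Lemma lmod_quotP (x y : V) :
  reflect (x = y %[mod lmod_quot]) (x - y \in B).
Proof.
by apply: (iffP idP) => [?|/eqP]; [apply/eqP|]; rewrite piE.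
Qed.

Definition lmod_quot_scale (a : k) (x : lmod_quot) : lmod_quot :=
  \pi_lmod_quot (a *: repr x).

Lemma lmod_quot_piZ (a : k) (x : V) :
  \pi_lmod_quot (a *: x) = lmod_quot_scale a (\pi_lmod_quot x).
Proof.
by apply/lmod_quotP; rewrite -scalerBr rpredZ //; apply/lmod_quotP; rewrite reprK.
Qed.

Lemma lmod_quot_piD (x y : V) :
  \pi_lmod_quot (x + y) = \pi_lmod_quot x + \pi_lmod_quot y.
Proof. exact: Quotient.pi_add. Qed.

Fact lmod_quot_scaleA a b x :
  lmod_quot_scale a (lmod_quot_scale b x) = lmod_quot_scale (a * b) x.
Proof. by elim/quotW: x => x; rewrite -(lmod_quot_piZ b) -!lmod_quot_piZ scalerA. Qed.

Fact lmod_quot_scale1 : left_id 1 lmod_quot_scale.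
Proof. by elim/quotW=> x; rewrite -lmod_quot_piZ scale1r. Qed.

Fact lmod_quot_scaleDr : right_distributive lmod_quot_scale +%R.
Proof.
by move=> a; elim/quotW=> x; elim/quotW=> y; rewrite -lmod_quot_piD -!lmod_quot_piZ scalerDr lmod_quot_piD.
Qed.

Fact lmod_quot_scaleDl x :
  {morph lmod_quot_scale^~ x : a b / a + b}.
Proof. by elim/quotW: x => x a b /=; rewrite -!lmod_quot_piZ scalerDl lmod_quot_piD. Qed.

HB.instance Definition _ := GRing.Zmodule_isLmodule.Build k lmod_quot
  lmod_quot_scaleA lmod_quot_scale1 lmod_quot_scaleDr lmod_quot_scaleDl.

End LmodQuotient.

Definition has_dim (k : fieldType) (V : lmodType k) (n : nat) : Prop :=
  inhabited (Vector.axiom n V).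

Section WeightedH1.
Variables (k : fieldType) (L : lieAlgType k).

Lemma lie0l (x : L) : lie 0 x = 0.
Proof.
have := lie_linearl x 1 0 0.
by rewrite !scale1r addr0 => /eqP; rewrite -subr_eq subrr => /eqP.
Qed.

Lemma lie0r (x : L) : lie x 0 = 0.
Proof.
have := lie_linearr x 1 0 0.
by rewrite !scale1r addr0 => /eqP; rewrite -subr_eq subrr => /eqP.
Qed.

Definition derivation (w : L -> L) : Prop :=
  linear w /\ forall x y, w (lie x y) = lie (w x) y + lie x (w y).

Definition inner_derivation (w : L -> L) : Prop :=
  exists x, forall y, w y = lie x y.

(* The basis is [e s] for [s >= 1]; [e] is to be extended by [0] to [s <= 0]. *)
Variable e : int -> L.

Definition has_weight (l : int) (w : L -> L) : Prop :=
  exists a : nat -> k, forall i : nat, (1 <= i)%N -> w (e i) = a i *: e (i%:Z + l).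

Definition weight_der (l : int) : {pred (L -> L)} :=
  fun w => `[< derivation w /\ has_weight l w >].

Fact weight_der_closed l : submod_closed (weight_der l).
Proof.
split=> [|c u v /asboolP[[uL uD] [a ua]] /asboolP[[vL vD] [b vb]]]; apply/asboolP.
  have f0 x : (0 : L -> L) x = 0 by [].
  split; last by exists (fun=> 0) => i _; rewrite scale0r.
  split=> [d x y|x y]; first by rewrite !f0 scaler0 addr0.
  by rewrite !f0 lie0l lie0r addr0.
have cuvE x : (c *: u + v) x = c *: u x + v x by [].
split; last first.
  exists (fun i => c * a i + b i) => i i_gt0.
  by rewrite cuvE ua // vb // scalerA scalerDl.
split=> [d x y|x y]; rewrite !cuvE.
  rewrite uL vL !scalerDr !scalerA [c * d]mulrC -!addrA; congr (_ + _).
  by rewrite addrCA.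
rewrite uD vD !scalerDr lie_linearl lie_linearr -!addrA; congr (_ + _).
by rewrite addrCA.
Qed.

HB.instance Definition _ l :=
  GRing.isSubmodClosed.Build k (L -> L) (weight_der l) (weight_der_closed l).

Record Z1 (l : int) : Type :=
  MkZ1 { Z1_fun :> L -> L; Z1_funP : Z1_fun \in weight_der l }.
HB.instance Definition _ l := [isSub for @Z1_fun l].
HB.instance Definition _ l := [Choice of Z1 l by <:].
HB.instance Definition _ l := [SubChoice_isSubLmodule of Z1 l by <:].

Definition B1 (l : int) : {pred Z1 l} := fun w => `[< inner_derivation w >].
Arguments B1 : clear implicits.

Fact B1_closed l : submod_closed (B1 l).
Proof.
split=> [|c u v /asboolP[x ux] /asboolP[y vy]]; apply/asboolP.
  by exists 0 => z; rewrite lie0l.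
by exists (c *: x + y) => z; rewrite lie_linearl -ux -vy.
Qed.
HB.instance Definition _ l := GRing.isSubmodClosed.Build k (Z1 l) (B1 l) (B1_closed l).

Definition H1 (l : int) : lmodType k := lmod_quot (B1 l).

End WeightedH1.
Arguments B1 {k L} e l _.

(* [m0 k] is the space of finitely supported coefficient sequences, carried by
   [{poly k}]: the coefficient [p`_n] is the coordinate of [p] on [e_(n + 1)]. *)
Definition m0 (k : fieldType) : Type := {poly k}.
HB.instance Definition _ (k : fieldType) := GRing.Lmodule.copy (m0 k) {poly k}.

Section M0.
Variable k : fieldType.

Definition m0_e (s : int) : m0 k :=
  if s is Posz n.+1 then ('X^n : {poly k}) else 0.

Lemma m0_basis (p : {poly k}) :
  (p : m0 k) = \sum_(i < size p) p`_i *: m0_e i.+1.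
Proof. by rewrite -{1}[p]coefK poly_def. Qed.

(* The structure constants: [m0_table i j] is [e_i, e_j] for [i, j >= 1]. *)
Definition m0_table (i j : nat) : m0 k :=
  if (i == 1)%N && (1 < j)%N then m0_e j.+1
  else if (j == 1)%N && (1 < i)%N then - m0_e i.+1
  else 0.

Definition m0_lie (p q : m0 k) : m0 k :=
  \sum_(i < size (p : {poly k})) \sum_(j < size (q : {poly k}))
    ((p : {poly k})`_i * (q : {poly k})`_j) *: m0_table i.+1 j.+1.

Lemma m0_lieE (p q : {poly k}) :
  m0_lie p q = 'X * (p`_0 *: q - q`_0 *: p) :> {poly k}.
Proof.
have tabE (i j : nat) : m0_table i.+1 j.+1 =
    (i == 0)%:R *: ('X * 'X^j : {poly k}) - (j == 0)%:R *: ('X * 'X^i : {poly k}).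
  rewrite -!exprS; case: i j => [|i] [|j];
  by rewrite /m0_table /= ?scale1r ?scale0r ?subrr ?subr0 ?sub0r.
have sumE (r : {poly k}) (c : nat -> k) : (forall i, (size r <= i)%N -> c i = 0) ->
    \sum_(i < size r) c i * (val i == 0)%:R = c 0.
  case: (size r) => [|n] c0; first by rewrite big_ord0 c0.
  by rewrite big_ord_recl /= mulr1 big1 ?addr0 // => i _; rewrite mulr0.
have coefs (r : {poly k}) : r = \sum_(i < size r) r`_i *: 'X^i.
  by rewrite -poly_def coefK.
rewrite /m0_lie (eq_bigr (fun i : 'I_(size p) =>
   (p`_i * (val i == 0)%:R) *: ('X * q) - (q`_0 * p`_i) *: ('X * 'X^i))).
  rewrite sumrB -scaler_suml sumE => [|i /(nth_default 0) //].
  rewrite mulrBr -!scalerAr; congr (_ - _).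
  rewrite [in RHS](coefs p) mulr_sumr scaler_sumr.
  by apply: eq_bigr => i _; rewrite -scalerAr scalerA.
move=> i _; under eq_bigr => j _ do rewrite tabE scalerBr !scalerA.
rewrite sumrB; congr (_ - _).
  rewrite [in RHS](coefs q) mulr_sumr scaler_sumr.
  apply: eq_bigr => j _; rewrite -scalerAr scalerA.
  by rewrite mulrAC.
rewrite -scaler_suml; congr (_ *: _).
under eq_bigr => j _ do rewrite -mulrA.
rewrite -mulr_sumr [RHS]mulrC; congr (_ * _).
by apply: (sumE q (fun j => q`_j)) => j /(nth_default 0).
Qed.

Fact m0_lie_linearl (q : m0 k) : linear (fun p => m0_lie p q).
Proof.
move=> a x y; rewrite !m0_lieE.
have E (u v w : {poly k}) (c d e : k) :
    'X * ((a * c + d) *: u - e *: (a *: v + w))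
    = a *: ('X * (c *: u - e *: v)) + 'X * (d *: u - e *: w).
  by rewrite -!mul_polyC polyCD polyCM; ring.
by rewrite coefD coefZ; exact: E.
Qed.

Fact m0_lie_linearr (p : m0 k) : linear (m0_lie p).
Proof.
move=> a x y; rewrite !m0_lieE.
have E (u v w : {poly k}) (c d e : k) :
    'X * (e *: (a *: v + w) - (a * c + d) *: u)
    = a *: ('X * (e *: v - c *: u)) + 'X * (e *: w - d *: u).
  by rewrite -!mul_polyC polyCD polyCM; ring.
by rewrite coefD coefZ; exact: E.
Qed.

Fact m0_liexx (p : m0 k) : m0_lie p p = 0.
Proof. by rewrite m0_lieE subrr mulr0. Qed.

Fact m0_jacobi (x y z : m0 k) :
  m0_lie x (m0_lie y z) + m0_lie y (m0_lie z x) + m0_lie z (m0_lie x y) = 0.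
Proof.
have E (u v w : {poly k}) (c d e : k) :
    'X * (c *: ('X * (d *: w - e *: v)) - 0 *: u)
    + 'X * (d *: ('X * (e *: u - c *: w)) - 0 *: v)
    + 'X * (e *: ('X * (c *: v - d *: u)) - 0 *: w) = 0.
  by rewrite !scale0r -!mul_polyC; ring.
rewrite !m0_lieE !coefXM /=; exact: E.
Qed.

HB.instance Definition _ := Lmodule_isLieAlgebra.Build k (m0 k)
  m0_lie_linearl m0_lie_linearr m0_liexx m0_jacobi.

Lemma m0_lie_e1 (i : nat) : (2 <= i)%N ->
  lie (m0_e 1) (m0_e i) = m0_e i.+1 :> m0 k.
Proof.
case: i => [|[|i]] // _; rewrite [lie _ _]m0_lieE /= expr0 coef1 coefXn /=.
by rewrite scale1r scale0r subr0 -exprS.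
Qed.

Lemma m0_lie_e0 (i j : nat) : (2 <= i)%N -> (2 <= j)%N ->
  lie (m0_e i) (m0_e j) = 0 :> m0 k.
Proof.
case: i j => [|[|i]] [|[|j]] // _ _; rewrite [lie _ _]m0_lieE /= !coefXn /=.
by rewrite !scale0r subr0 mulr0.
Qed.

End M0.

(* Main.v *)
Require Import Defs.
From mathcomp Require Import all_boot all_order all_algebra.
From mathcomp Require Import boolp ring.

(* As [e_1] and [e_2] generate [m0], a derivation is determined by its values
   [w e_1 = a e_(l+1)] and [w e_2 = b e_(l+2)]. For [l >= 1] every pair [(a, b)]
   occurs, and the inner derivations of weight [l] form the line [b = 0] (spanned
   by [ad e_l]) if [l >= 2], and the line [a = 0] (spanned by [ad e_1]) if [l = 1].
   For [l = 0] every pair occurs and only [0] is inner. For [l <= -1] the value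
   [w e_1] vanishes, and so does [w e_2]: trivially if [l <= -2], and by applying
   [w] to [[e_2, e_3] = 0] if [l = -1]. *)

Import GRing.Theory Num.Theory.
Local Open Scope ring_scope.
Local Open Scope quotient_scope.

(** First isomorphism theorem: a surjection with kernel [B] induces an isomorphism from the quotient
    onto the row space. Here [f] will read off coefficients of a derivation. *)
Lemma has_dim_lmod_quot (k : fieldType) (V : lmodType k) (B : submodClosed V)
    (n : nat) (f : V -> 'rV[k]_n) :
    linear f -> (forall r, exists v, f v = r) ->
    (forall v, (v \in B) = (f v == 0)) ->
  has_dim (lmod_quot B) n.
Proof.
move=> f_lin /choice[g gK] kerf.
have fB u v : f (u - v) = f u - f v.
  by rewrite -[in LHS]scaleN1r addrC f_lin scaleN1r addrC.
have f_pi v : f (repr (\pi_(lmod_quot B) v)) = f v.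
  apply/eqP; rewrite -subr_eq0 -fB -kerf; apply/lmod_quotP.
  by rewrite reprK.
constructor; exists (fun x : lmod_quot B => f (repr x)).
  move=> a; elim/quotW=> u; elim/quotW=> v.
  have -> : a *: \pi_(lmod_quot B) u = \pi_(lmod_quot B) (a *: u).
    by rewrite lmod_quot_piZ.
  by rewrite -lmod_quot_piD !f_pi f_lin.
exists (fun r => \pi_(lmod_quot B) (g r)) => [|r]; last by rewrite f_pi gK.
elim/quotW=> v; rewrite f_pi; apply/lmod_quotP.
by rewrite kerf fB gK subrr.
Qed.

Section M0Derivations.
Variable k : fieldType.
Local Notation e := (m0_e k).
Implicit Types (p x : {poly k}) (u v w : m0 k -> m0 k) (c d : k) (l : nat).

Lemma m0_lier_e1 x : lie (x : m0 k) (e 1) = 'X * ((x`_0)%:P - x) :> {poly k}.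
Proof. by rewrite [lie _ _]m0_lieE /= expr0 coefC /= scale1r alg_polyC. Qed.

Lemma m0_lier_e2 x : lie (x : m0 k) (e 2) = x`_0 *: 'X^2 :> {poly k}.
Proof. by rewrite [lie _ _]m0_lieE /= coefXn scale0r subr0 -scalerAr -exprS. Qed.

Lemma derivation_ext u v : derivation u -> derivation v ->
  u (e 1) = v (e 1) -> u (e 2) = v (e 2) -> u =1 v.
Proof.
move=> [u_lin uD] [v_lin vD] uv1 uv2 p.
have uve i : u (e i.+1) = v (e i.+1).
  elim: i => [//|[_ //|i IHi]].
  (* Agreement propagates along [e_(i+3) = [e_1, e_(i+2)]]. *)
  by rewrite -m0_lie_e1 // uD vD uv1 IHi.
have lin0 w : linear w -> w 0 = 0.
  by move=> w_lin; rewrite -[X in w X](addNr 0) -scaleN1r w_lin scaleN1r addNr.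
rewrite [p]m0_basis; elim/big_rec: _ => [|i q _ IHq]; first by rewrite !lin0.
by rewrite u_lin v_lin uve IHq.
Qed.

Lemma ad_derivation (x : m0 k) : derivation (lie x).
Proof.
split=> [|y z]; first exact: lie_linearr.
rewrite ![lie _ _]m0_lieE !coefXM /= !scale0r !subr0 !sub0r -!mul_polyC.
by ring.
Qed.

(** Since [lie x] is itself a derivation, it has to be compared with [w] only on the two
    generators. *)
Lemma inner_derivationP w : derivation w ->
  inner_derivation w <-> exists x : m0 k,
    w (e 1) = lie x (e 1) /\ w (e 2) = lie x (e 2).
Proof.
move=> wD; split=> [[x wx]|[x [w1 w2]]]; exists x; first by rewrite !wx.
exact: derivation_ext wD (ad_derivation x) w1 w2.
Qed.

(** The pair [(a, b)] of the overview; indices drop by one because [e_(n+1)] is ['X^n]. *)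
Definition e1_coef l w : k := (w (e 1) : {poly k})`_l.
Definition e2_coef l w : k := (w (e 2) : {poly k})`_l.+1.

Lemma Z1_e1 l (w : Z1 e l) : w (e 1) = e1_coef l w *: 'X^l :> {poly k}.
Proof.
case: w => w /= /asboolP[_ [a wa]].
by rewrite /e1_coef wa // -PoszD coefZ coefXn eqxx mulr1.
Qed.

Lemma Z1_e2 l (w : Z1 e l) : w (e 2) = e2_coef l w *: 'X^(l.+1) :> {poly k}.
Proof.
case: w => w /= /asboolP[_ [a wa]].
by rewrite /e2_coef wa // -PoszD coefZ coefXn eqxx mulr1.
Qed.

Lemma Z1_derivation (l : int) (w : Z1 e l) : derivation w.
Proof. by case: w => w /= /asboolP[]. Qed.

Lemma Z1_weight (l : int) (w : Z1 e l) : has_weight e l w.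
Proof. by case: w => w /= /asboolP[]. Qed.

Lemma mem_B1 (l : int) (w : Z1 e l) : w \in B1 e l <->
  exists x : m0 k, w (e 1) = lie x (e 1) /\ w (e 2) = lie x (e 2).
Proof.
rewrite -inner_derivationP; last exact: Z1_derivation.
by split=> [/asboolP|?]; last apply/asboolP.
Qed.

Lemma Z1_exists_ge1 l c d : (0 < l)%N ->
  exists w : Z1 e l, e1_coef l w = c /\ e2_coef l w = d.
Proof.
move=> l_gt0.
(* The shift by [l], with factor [c] on [e_1] and [d] on every other [e_i]. As [l > 0], its values
   have no [e_1] component, which gives the Leibniz rule. *)
pose w p : {poly k} := 'X^l * (d *: p + ((c - d) * p`_0)%:P).
have wP : (w : m0 k -> m0 k) \in weight_der e l.
  apply/asboolP; split.
    split=> [a p q|p q].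
      by rewrite /w coefD coefZ -!mul_polyC !polyCM !polyCD polyCM; ring.
    rewrite ![lie _ _]m0_lieE /w !coefXM !coefXnM /= l_gt0 -!mul_polyC.
    by rewrite !polyCM !polyCB; ring.
  exists (fun i => if i == 1%N then c else d) => -[//|i] _.
  rewrite -PoszD addSn /= /w coefXn.
  case: i => [|i] /=; rewrite ?mulr0 ?mulr1 exprD -!mul_polyC.
    by rewrite expr0 polyCB; ring.
  by rewrite polyC0 addr0; ring.
exists (MkZ1 wP); rewrite /e1_coef /e2_coef /= /w !coefXnM ltnn ltnNge leqnSn /=.
by rewrite subnn subSnn !coefD !coefZ !coefC !coefXn /=; split; ring.
Qed.

Lemma Z1_exists_0 c d : exists w : Z1 e 0, e1_coef 0 w = c /\ e2_coef 0 w = d.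
Proof.
(* A combination of two grading derivations: [e_i] to [i e_i], and the one killing [e_1] and fixing
   the other [e_i]. Then [e_2] has eigenvalue [2c + (d - 2c) = d]. *)
pose w p : {poly k} := c *: ('X * p)^`() + (d - c *+ 2) *: (p - (p`_0)%:P).
have wP : (w : m0 k -> m0 k) \in weight_der e 0.
  apply/asboolP; split.
    split=> [a p q|p q].
      by rewrite /w coefD coefZ !derivE -!mul_polyC !polyCD !polyCM; ring.
    rewrite ![lie _ _]m0_lieE /w !coefXM polyC0 !derivE !coefD !coefZ !coefB.
    rewrite !coefC !coefD !coefXM !mul1r /= !subrr !addr0 !mulr0 !addr0 -!mul_polyC.
    by rewrite !polyCM; ring.
  exists (fun i => c * i%:R + (i != 1%N)%:R * (d - c *+ 2)) => -[//|i] _.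
  rewrite addr0 /w -[e i.+1]/('X^i : {poly k}) -exprS derivXn coefXn eqSS eq_sym.
  rewrite -!mul_polyC [in RHS]polyCD !polyCM !polyC_natr -mulr_natr /=.
  case: eqP => [->|_] /=; last by rewrite mulr0n subr0; ring.
  by rewrite expr0; ring.
exists (MkZ1 wP); rewrite /e1_coef /e2_coef /= /w expr0 mulr1 derivX -expr2 derivXn.
rewrite !coefD !coefZ !coefB !coefMn !coefC !coefXn /=.
by split; ring.
Qed.

Lemma e1_coef_linear l a (u v : Z1 e l) :
  e1_coef l (a *: u + v) = a * e1_coef l u + e1_coef l v.
Proof. by rewrite /e1_coef -coefZ -coefD. Qed.

Lemma e2_coef_linear l a (u v : Z1 e l) :
  e2_coef l (a *: u + v) = a * e2_coef l u + e2_coef l v.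
Proof. by rewrite /e2_coef -coefZ -coefD. Qed.

Lemma mem_B1_ge2 l (w : Z1 e l.+2) : (w \in B1 e l.+2) = (e2_coef l.+2 w == 0).
Proof.
apply/idP/eqP => [/mem_B1[x [_ w2]]|w2].
  (* [[x, e_2]] is a multiple of [e_3], too low to meet [e_(l+4)]. *)
  by rewrite /e2_coef w2 m0_lier_e2 coefZ coefXn mulr0.
(* A multiple of [e_(l+2)]; the sign comes from [[e_(l+2), e_1] = - e_(l+3)]. *)
apply/mem_B1; exists (- e1_coef l.+2 w *: 'X^(l.+1) : {poly k}).
rewrite m0_lier_e1 m0_lier_e2 Z1_e1 Z1_e2 w2 !coefZ coefXn mulr0 !scale0r.
by rewrite polyC0 sub0r scaleNr opprK -scalerAr -exprS.
Qed.

Lemma mem_B1_1 (w : Z1 e 1) : (w \in B1 e 1) = (e1_coef 1 w == 0).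
Proof.
apply/idP/eqP => [/mem_B1[x [w1 _]]|w1].
  (* [[x, e_1]] has no [e_2] component, because [[e_1, e_1] = 0]. *)
  by rewrite /e1_coef w1 m0_lier_e1 coefXM /= coefB coefC subrr.
apply/mem_B1; exists ((e2_coef 1 w)%:P : {poly k}).
by rewrite m0_lier_e1 m0_lier_e2 Z1_e1 Z1_e2 w1 !coefC /= subrr mulr0 scale0r.
Qed.

Lemma mem_B1_0 (w : Z1 e 0) :
  (w \in B1 e 0) = (e1_coef 0 w == 0) && (e2_coef 0 w == 0).
Proof.
apply/idP/andP => [/mem_B1[x [w1 w2]]|[/eqP w1 /eqP w2]].
  (* Bracketing raises degree: [[x, e_1]] has no [e_1] component and [[x, e_2]] no [e_2]
     component. *)
  by rewrite /e1_coef /e2_coef w1 w2 m0_lier_e1 m0_lier_e2 coefXM coefZ coefXn mulr0.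
apply/mem_B1; exists 0.
by rewrite !lie0l Z1_e1 Z1_e2 w1 w2 !scale0r.
Qed.

Lemma mem_B1_neg (m : nat) (w : Z1 e (Negz m)) : w \in B1 e (Negz m).
Proof.
have [_ wD] := Z1_derivation _ w; have [a wa] := Z1_weight _ w.
apply/mem_B1; exists 0; rewrite !lie0l.
have w1 : w (e 1) = 0 by rewrite wa //; case: (m) => [|?]; rewrite scaler0.
(* [Negz m] is [-(m+1)], so for positive [m] the image of [e_2] has index at most 0 and vanishes;
   [m = 0] is weight -1. *)
split=> //; case: m => [|m] in w wD a wa w1 *; last first.
  by rewrite wa //; case: m {w wD wa w1} => [|m]; rewrite scaler0.
have w2 : w (e 2) = a 2%N *: e 1 by rewrite wa.
have w3 : w (e 3) = 0.
  by rewrite -m0_lie_e1 // wD w1 lie0l add0r w2 -[_ *: _]addr0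
     lie_linearr lie0r liexx scaler0 addr0.
have w0 : w 0 = 0 by have := wD 0 0; rewrite !(lie0l, lie0r) addr0.
(* The Leibniz rule here reads [0 = [a_2 e_1, e_3] = a_2 e_4], whence [a_2 = 0]. *)
have := wD (e 2) (e 3); rewrite m0_lie_e0 // w3 lie0r addr0 w2.
rewrite -[_ *: _]addr0 lie_linearl lie0l m0_lie_e1 // !addr0 w0.
move/(congr1 (fun p : {poly k} => p`_3)).
by rewrite coef0 coefZ coefXn mulr1 => <-; rewrite scale0r.
Qed.

End M0Derivations.

Lemma scalar_mx11_eq0 (R : pzRingType) (a : R) : (a%:M == 0 :> 'M_1) = (a == 0).
Proof.
apply/eqP/eqP => [/matrixP/(_ 0 0)|->]; first by rewrite !mxE.
by rewrite raddf0.
Qed.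

Theorem theorem2 (k : fieldType) (char0 : [pchar k] =i pred0) (l : int) :
  [/\ 1 <= l -> has_dim (H1 (m0_e k) l) 1%N,
      l = 0 -> has_dim (H1 (m0_e k) l) 2%N
    & l <= -1 -> has_dim (H1 (m0_e k) l) 0%N].
Proof.
split.
(* The coefficient that survives modulo inner derivations is [e1_coef] for weight 1 and [e2_coef]
   from weight 2 on. *)
- case: l => [[|[|l]]|m] // _.
  + apply: (@has_dim_lmod_quot _ _ _ _ (fun w : Z1 _ 1 => (e1_coef _ 1 w)%:M)).
    * by move=> a u v; rewrite e1_coef_linear scale_scalar_mx -raddfD.
    * move=> r; have [w [w1 _]] := @Z1_exists_ge1 _ 1 (r 0 0) 0 isT.
      by exists w; rewrite w1 -mx11_scalar.
    * by move=> w; rewrite scalar_mx11_eq0 mem_B1_1.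
  + apply: (@has_dim_lmod_quot _ _ _ _ (fun w : Z1 _ l.+2 => (e2_coef _ l.+2 w)%:M)).
    * by move=> a u v; rewrite e2_coef_linear scale_scalar_mx -raddfD.
    * move=> r; have [w [_ w2]] := @Z1_exists_ge1 _ l.+2 0 (r 0 0) isT.
      by exists w; rewrite w2 -mx11_scalar.
    * by move=> w; rewrite scalar_mx11_eq0 mem_B1_ge2.
- move=> ->.
  apply: (@has_dim_lmod_quot _ _ _ (1 + 1)%N
    (fun w : Z1 _ 0 => row_mx (e1_coef _ 0 w)%:M (e2_coef _ 0 w)%:M)).
  + move=> a u v; rewrite e1_coef_linear e2_coef_linear scale_row_mx add_row_mx.
    by rewrite !scale_scalar_mx -!raddfD.
  + move=> r; have [w [w1 w2]] := Z1_exists_0 _ (lsubmx r 0 0) (rsubmx r 0 0).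
    by exists w; rewrite w1 w2 -!mx11_scalar hsubmxK.
  + by move=> w; rewrite row_mx_eq0 !scalar_mx11_eq0 mem_B1_0.
- case: l => [//|m] _.
  (* The zero map is onto ['rV_0], and its kernel is everything, as is [B1]. *)
  apply: (@has_dim_lmod_quot _ _ _ _ (fun=> 0)) => [a u v|r|w].
  + by rewrite scaler0 addr0.
  + by exists 0; rewrite thinmx0.
  + by rewrite eqxx mem_B1_neg.
Qed.
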